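(* Consider the one-dimensional OFDM signal $\mathbf{x}=\mathbf{F}_N^H\mathbf{s}$ of length $N$ with $L$ deterministic unit-amplitude pilots on an index set $I\subseteq\mathbb{Z}_N$ and i.i.d. random data symbols on the remaining indices, as set out in the context. Then, for an arbitrary pilot design (arbitrary pattern $I$ with $L$ elements and arbitrary unit-amplitude pilot symbols), for all $(k,q)\in\mathbb{Z}_N^2$ with $q\neq 0$, $$\mathbb{E}\left(|\mathcal{X}^{\mathrm{DP}}(k,q)|^2\right)\geq N-h(q)\geq N-L$$ and $$\mathbb{E}\left(|\mathcal{X}^{\mathrm{DP}}(k,q)|^2\right)\leq N+h^2(q)-h(q)\leq N+L^2-L,$$ where $h(q)=\sum_{n=0}^{N-1}w_n w_{\langle n-q\rangle_N}$.
   Context: Let $j$ be the imaginary unit, $N\ge 1$, $0\le L\le N$, $\mathbb{Z}_N=\{0,1,\dots,N-1\}$, and $\langle\cdot\rangle_N$ denote reduction modulo $N$. Indices start from $0$. $\mathbf{F}_N$ is the normalized DFT matrix with entries $(\mathbf{F}_N)_{m,n}=\frac{1}{\sqrt N}e^{-j2\pi mn/N}$. Signal model. $I\subseteq\mathbb{Z}_N$ is a set with $L$ elements (pilot pattern). The symbol vector $\mathbf{s}\in\mathbb{C}^N$ has deterministic pilot entries $s_i$ with $|s_i|=1$ for $i\in I$ (unit-amplitude pilots), while the entries $s_i$, $i\notin I$, are i.i.d. random data symbols, each distributed as a complex random variable $d$ with finite fourth moment and $$\mathbb{E}(d)=0,\quad \mathbb{E}(|d|^2)=1,\quad \mathbb{E}(d^2)=0,\quad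 \mathbb{E}(d|d|^2)=\mathbb{E}(d^*|d|^2)=0.$$ The binary pilot mask $\mathbf{w}$ has $w_i=1$ for $i\in I$ and $w_i=0$ otherwise. Ambiguity function. $\mathbf{R}_{N,k}$ is the cyclic shift, $(\mathbf{R}_{N,k}\mathbf{x})_n=x_{\langle n-k\rangle_N}$, and $\mathbf{\Phi}_{N,q}=\mathrm{Diag}(1,e^{j2\pi q/N},\dots,e^{j2\pi q(N-1)/N})$. The discrete periodic ambiguity function (DP-AF) is $\mathcal{X}^{\mathrm{DP}}(k,q)=\mathbf{x}^H\mathbf{R}_{N,k}^T\mathbf{\Phi}_{N,q}^*\mathbf{x}$ with $\mathbf{x}=\mathbf{F}_N^H\mathbf{s}$, for $(k,q)\in\mathbb{Z}_N^2$. *)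

(* Defs.v *)
From HB Require Import structures.
From mathcomp Require Import all_boot all_order all_algebra.
From mathcomp Require Import all_classical all_reals all_analysis.
From mathcomp Require Import complex.

Set Implicit Arguments.
Unset Strict Implicit.
Unset Printing Implicit Defensive.

Import Order.TTheory GRing.Theory Num.Theory.
Import numFieldNormedType.Exports.

Local Open Scope classical_set_scope.
Local Open Scope ring_scope.
Local Open Scope complex_scope.
Local Open Scope sesquilinear_scope.

Section BorelComplex.
Context {R : realType}.

(* Borel sigma-algebra of R[i], transported from the product sigma-algebra
   of R * R along (a, b) |-> a +i* b *)
Definition complex_of_pair (p : measurableTypeR R * measurableTypeR R) : R[i] :=
  p.1 +i* p.2.

Definition measurable_complex : set (set R[i]) :=
  [set A | measurable (complex_of_pair @^-1` A)].

Lemma measurable_complex0 : measurable_complex set0.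
Proof. by rewrite /measurable_complex /= preimage_set0. Qed.

Lemma measurable_complexC A : measurable_complex A -> measurable_complex (~` A).
Proof. by move=> mA; rewrite /measurable_complex /= preimage_setC; exact: measurableC. Qed.

Lemma measurable_complex_bigcup (F : (set R[i])^nat) :
  (forall i, measurable_complex (F i)) -> measurable_complex (\bigcup_i F i).
Proof.
move=> mF; rewrite /measurable_complex /= preimage_bigcup.
by apply: bigcup_measurable => i _; exact: mF.
Qed.

Fact complex_display : measure_display. Proof. by constructor. Qed.

HB.instance Definition _ := isPointed.Build R[i] 0.
HB.instance Definition _ := @isMeasurable.Build complex_display R[i]
  measurable_complex measurable_complex0 measurable_complexC
  measurable_complex_bigcup.

End BorelComplex.

Section Probability.
Context {R : realType}.

(* only meaningful when both parts of X are integrable (fine +oo = 0) *)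
Definition expectationC d (T : measurableType d) (P : probability T R)
    (X : T -> R[i]) : R[i] :=
  fine 'E_P[fun t => complex.Re (X t)] +i* fine 'E_P[fun t => complex.Im (X t)].

Definition same_law d1 d2 d' (T1 : measurableType d1) (T2 : measurableType d2)
    (T' : measurableType d') (P1 : probability T1 R) (P2 : probability T2 R)
    (X1 : {RV P1 >-> T'}) (X2 : {RV P2 >-> T'}) : Prop :=
  forall B, measurable B -> distribution P1 X1 B = distribution P2 X2 B.

Definition mutually_independent d d' (T : measurableType d)
    (T' : measurableType d') (P : probability T R) (I : finType) (A : {set I})
    (X : I -> {RV P >-> T'}) : Prop :=
  forall (J : {set I}) (B : I -> set T'), J \subset A ->
    (forall i, i \in J -> measurable (B i)) ->
    P (\bigcap_(i in [set` J]) (X i @^-1` B i)) =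
    (\prod_(i in J) P (X i @^-1` B i))%E.

End Probability.

Section AmbiguityFunction.
Context {R : realType} {N : nat}.

Definition expj (x : R) : R[i] := cos x +i* sin x.

(* <n - k>_N *)
Definition subI (n k : 'I_N) : 'I_N :=
  Ordinal (ltn_pmod (n + (N - k)) (leq_ltn_trans (leq0n n) (ltn_ord n))).

Definition dft : 'M[R[i]]_N :=
  \matrix_(m, n) ((Num.sqrt N%:R)^-1%:C *
                  expj (- (2 * pi * (m * n)%N%:R / N%:R))).

Definition cshift (k : 'I_N) : 'M[R[i]]_N :=
  \matrix_(n, m) (m == subI n k)%:R.

Definition modulation (q : 'I_N) : 'M[R[i]]_N :=
  diag_mx (\row_n expj (2 * pi * (q * n)%N%:R / N%:R)).

Definition ofdm (s : 'cV[R[i]]_N) : 'cV[R[i]]_N := dft ^t* *m s.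

Definition dpaf (x : 'cV[R[i]]_N) (k q : 'I_N) : R[i] :=
  (x ^t* *m (cshift k)^T *m map_mx Num.conj (modulation q) *m x) ord0 ord0.

End AmbiguityFunction.

Definition mask (N : nat) (I : {set 'I_N}) (i : 'I_N) : nat := i \in I.

Definition overlap (N : nat) (I : {set 'I_N}) (q : 'I_N) : nat :=
  (\sum_(n < N) mask I n * mask I (subI n q))%N.

(* Main.v *)
From Pilot Require Import Defs.
From mathcomp Require Import all_boot all_order all_algebra.
From mathcomp Require Import all_classical all_reals all_analysis.
From mathcomp Require Import measurable_realfun.
From mathcomp Require Import complex.
From mathcomp Require Import ring lra zify.
Import Order.TTheory GRing.Theory Num.Theory.
Import numFieldNormedType.Exports.
Local Open Scope classical_set_scope.
Local Open Scope ring_scope.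
Local Open Scope complex_scope.

(** Orthogonality of the roots of unity turns the ambiguity function into a
    single sum X = sum_n c_n s_n (s_(n-q))^* with |c_n| = 1. In E|X|^2 each of
    the N diagonal terms is 1, as q <> 0. An off-diagonal term (n, m) factors
    over the symbols by independence, and a data symbol can enter it only
    through E(d), E(d^2) or their conjugates, all zero; so it survives only if
    n, n-q, m and m-q are all pilots. Hence E|X|^2 = N - h(q) + |S|^2, where S is
    a sum of h(q) numbers of modulus 1, and 0 <= |S| <= h(q). *)

(** * Expectations of products of independent variables *)

(** Independence is a statement about events, while the expectations to be factored are those of
    products of unbounded complex variables; the product formula is therefore built up from
    indicators through nonnegative real functions to complex ones. To fit it, each summand
    [s_n s_a^* s_m^* s_b], where [a = n - q] and [b = m - q], is rewritten as a product over all
    indices of one function per symbol, whatever the coincidences among the four indices. *)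

Section ProductFormula.
Local Set Implicit Arguments.
Local Unset Strict Implicit.
Context d (T : measurableType d) d' (T' : measurableType d') (R : realType).
Variable P : probability T R.

Import HBNNSimple.

(** Both sides are additive and monotonically continuous in [f], so indicators suffice. [W] stands
    for the product of the other factors and [c] for its expectation; asking only for the indicator
    formula, rather than for independence, lets the lemma be iterated one coordinate at a time. *)
Lemma ge0_integral_indep (X : {RV P >-> T'}) (W : T -> R) (c : R) (f : T' -> R) :
  measurable_fun setT W -> (forall t, 0 <= W t) ->
  (forall B, measurable B ->
    (\int[P]_t (\1_B (X t) * W t)%:E = P (X @^-1` B) * c%:E)%E) ->
  measurable_fun setT f -> (forall x, 0 <= f x) ->
  (\int[P]_t (f (X t) * W t)%:E = (\int[P]_t (f (X t))%:E) * c%:E)%E.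
Proof.
move=> mW W0 XW mf f0.
have mX : measurable_fun setT X by [].
have simple (h : {nnsfun T' >-> R}) :
  (\int[P]_t (h (X t) * W t)%:E = (\int[P]_t (h (X t))%:E) * c%:E)%E.
  have mhX k : measurable_fun setT (fun t => \1_(h @^-1` [set k]) (X t) : R).
    by apply: measurableT_comp => //; exact: measurable_indic.
  (* The weight [V] is general because both sides of the goal are expanded: the left with [V = W],
     the right with [V = 1]. *)
  have sumE (V : T -> R) : measurable_fun setT V -> (forall t, 0 <= V t) ->
    (\int[P]_t (h (X t) * V t)%:E = \sum_(k \in range h)
      k%:E * \int[P]_t (\1_(h @^-1` [set k]) (X t) * V t)%:E)%E.
    move=> mV V0.
    transitivity (\int[P]_t \sum_(k \in range h)
      (k * (\1_(h @^-1` [set k]) (X t) * V t))%:E)%E.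
      apply: eq_integral => t _; rewrite fimfunE mulr_fsuml fsumEFin//.
      by under eq_fsbigr do rewrite -mulrA.
    rewrite ge0_integral_fsum//.
    + apply: eq_fsbigr => k /set_mem [x _ <-].
      under eq_integral do rewrite EFinM.
      rewrite ge0_integralZl_EFin//.
      * by move=> t _; rewrite lee_fin mulr_ge0.
      * by apply/measurable_EFinP/measurable_funM.
    + move=> k; apply/measurable_EFinP/measurable_funM => //.
      exact/measurable_funM.
    + move=> k t _; rewrite mulrA EFinM mule_ge0 ?lee_fin//.
      exact: nnfun_muleindic_ge0.
  rewrite sumE//.
  under [in RHS]eq_integral do rewrite -[h _]mulr1.
  rewrite (sumE (fun=> 1))// muleC ge0_mule_fsumr; last first.
    move=> k; under eq_integral do rewrite mulr1.
    (* Pulling the constant into the sum needs nonnegative terms; a negative level [k] of [h >= 0]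
       has an empty level set. *)
    have [k0|k0] := leP 0 k.
      by rewrite mule_ge0// integral_ge0// => t _; rewrite lee_fin.
    rewrite (_ : h @^-1` [set k] = set0); last first.
      by apply/seteqP; split=> // x /= hx; move: k0; rewrite -hx ltNge fun_ge0.
    by under eq_integral do rewrite indic0; rewrite integral0 mule0.
  apply: eq_fsbigr => k _; rewrite XW; last exact: measurable_funPTI.
  under [in RHS]eq_integral do rewrite mulr1.
  rewrite [RHS]muleCA; congr mule; rewrite muleC; congr mule.
  rewrite (_ : (fun t => _) = EFin \o \1_(X @^-1` (h @^-1` [set k])))//.
  by rewrite integral_indic ?setIT//; exact: measurable_funPTI.
have mEf : measurable_fun setT (EFin \o f) by exact/measurable_EFinP.
pose g := nnsfun_approx measurableT mEf.
have gf x : EFin \o g^~ x @ \oo --> (f x)%:E.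
  by apply: cvg_nnsfun_approx => // y _ /=; rewrite lee_fin.
have gnd x m n : (m <= n)%N -> g m x <= g n x.
  by move=> mn; exact/lefP/nd_nnsfun_approx.
have mg n : measurable_fun setT (fun t => g n (X t)).
  by apply: measurableT_comp.
have cvg (V : T -> R) : measurable_fun setT V -> (forall t, 0 <= V t) ->
  (\int[P]_t (g n (X t) * V t)%:E @[n --> \oo] --> \int[P]_t (f (X t) * V t)%:E)%E.
  move=> mV V0.
  rewrite (_ : (\int[P]_t (f (X t) * V t)%:E =
     \int[P]_t limn (fun n => (g n (X t) * V t)%:E))%E); last first.
    apply: eq_integral => t _; apply/esym/cvg_lim => //.
    rewrite EFinM; under eq_fun do rewrite EFinM.
    by apply: cvgeZr => //; exact: gf.
  apply: cvg_monotone_convergence => //.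
  - by move=> n; apply/measurable_EFinP/measurable_funM.
  - by move=> n t _; rewrite lee_fin mulr_ge0.
  - by move=> t _ m n mn; rewrite lee_fin ler_wpM2r// gnd.
apply: (cvg_unique _ (cvg _ mW W0)) => //.
rewrite (_ : (fun n => _) = (fun n => (\int[P]_t (g n (X t))%:E) * c%:E)%E); last first.
  by apply/funext => n; exact: simple.
apply: cvgeZr => //.
have := cvg (fun=> 1) (measurable_cst _) (fun=> ler01).
under eq_fun do under eq_integral do rewrite mulr1.
by under [X in _ --> X]eq_integral do rewrite mulr1.
Qed.

End ProductFormula.

(** * Nonnegative functions of independent variables *)

Section Independence.
Local Set Implicit Arguments.
Local Unset Strict Implicit.
Context d (T : measurableType d) d' (T' : measurableType d') (R : realType).
Variables (P : probability T R) (I : finType) (X : I -> {RV P >-> T'}).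
Hypothesis indX : mutually_independent [set: I]%SET X.

(** The product of indicators is the indicator of the intersection of the preimages, so this is
    independence itself, taken with all coordinates. *)
Let integral_prod_indic (B : I -> set T') :
  (forall i, measurable (B i)) ->
  (\int[P]_t (\prod_i \1_(B i) (X i t))%:E =
   (\prod_i fine (\int[P]_t (\1_(B i) (X i t))%:E))%:E)%E.
Proof.
move=> mB.
have mXB i : measurable (X i @^-1` B i) by exact: measurable_funPTI.
rewrite (_ : (fun t => _) =
  EFin \o \1_(\bigcap_(i in [set` [set: I]%SET]) (X i @^-1` B i))); last first.
  apply/funext => t /=; congr EFin; rewrite indicE.
  have [tB|tB] := boolP (t \in _).
    apply: big1 => i _; rewrite indicE mem_set//.
    by move/set_mem : tB => /(_ i); apply; rewrite /= inE.
  apply/eqP/prodf_eq0.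
  have /existsNP[i /not_implyP[_ ni]] :
      ~ (\bigcap_(i in [set` [set: I]%SET]) (X i @^-1` B i)) t.
    by move=> h; move: tB; rewrite mem_set.
  by exists i => //; rewrite indicE memNset.
rewrite integral_indic ?setIT//; last first.
  by apply: fin_bigcap_measurable => //; exact: finite_finset.
transitivity (\prod_(i in [set: I]%SET) P (X i @^-1` B i))%E; first exact: indX.
rewrite -prodEFin.
apply: eq_big => [i|i _]; first by rewrite finset.inE.
rewrite (_ : (fun t => _) = EFin \o \1_(X i @^-1` B i))//.
by rewrite integral_indic ?setIT// fineK// fin_num_measure.
Qed.

Lemma ge0_integral_prod_indep (f : I -> T' -> R) :
  (forall i, measurable_fun setT (f i)) -> (forall i x, 0 <= f i x) ->
  (forall i, (\int[P]_t (f i (X i t))%:E < +oo)%E) ->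
  (\int[P]_t (\prod_i f i (X i t))%:E =
   (\prod_i fine (\int[P]_t (f i (X i t))%:E))%:E)%E.
Proof.
move=> mf f0 foo.
(* The coordinates outside s carry indicators: these are freed one at a time. *)
have : forall i, i \notin enum I -> exists2 B, measurable B & f i = \1_B.
  by move=> i; rewrite mem_enum.
elim: (enum I) f mf f0 foo => [|i0 s IHs] f mf f0 foo fs.
  have /choice[B BP] : forall i, exists B, measurable B /\ f i = \1_B.
    by move=> i; have [//|B mB fB] := fs i; exists B.
  under eq_integral do under eq_bigr do rewrite (BP _).2.
  rewrite integral_prod_indic; last by move=> i; exact: (BP i).1.
  by under [in RHS]eq_bigr do under eq_integral do rewrite (BP _).2.
rewrite (bigD1 i0)//= EFinM fineK; last first.
  by rewrite ge0_fin_numE// integral_ge0// => t _; rewrite lee_fin.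
under eq_integral do rewrite (bigD1 i0)//=.
apply: ge0_integral_indep => //.
- under eq_fun do rewrite -big_filter.
  by apply: measurable_prod => i _; exact: measurableT_comp.
- by move=> t; exact: prodr_ge0.
move=> B mB.
(* With [\1_B] at [i0], only the coordinates in [s] are still general, so the induction hypothesis
   yields the indicator formula that [ge0_integral_indep] requires. *)
pose f' i := if i == i0 then \1_B else f i.
have f'E i : i != i0 -> f' i = f i by rewrite /f' => /negPf->.
have f'0 : f' i0 = \1_B by rewrite /f' eqxx.
have intB : (\int[P]_t (\1_B (X i0 t))%:E = P (X i0 @^-1` B))%E.
  rewrite (_ : (fun t => _) = EFin \o \1_(X i0 @^-1` B))//.
  by rewrite integral_indic ?setIT//; exact: measurable_funPTI.
have := IHs f'; rewrite (bigD1 i0)//= EFinM f'0 intB fineK; last first.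
  by rewrite fin_num_measure//; exact: measurable_funPTI.
under eq_integral do (rewrite (bigD1 i0)//= f'0; under eq_bigr do rewrite f'E//).
under [X in _ -> _ -> _ -> _ -> _ = (_ * X%:E)%E]eq_bigr do rewrite f'E//.
apply.
- by move=> i; rewrite /f'; case: ifP => // _; exact: measurable_indic.
- by move=> i x; rewrite /f'; case: ifP.
- move=> i; rewrite /f'; case: ifP => // /eqP ->.
  by rewrite intB ltey_eq fin_num_measure//; exact: measurable_funPTI.
- move=> i is_; have [->|i0i] := eqVneq i i0; first by rewrite f'0; exists B.
  by rewrite f'E//; apply: fs; rewrite inE negb_or i0i.
Qed.

End Independence.

(** * Complex-valued random variables *)

Section ComplexExpectation.
Local Set Implicit Arguments.
Local Unset Strict Implicit.
Context {R : realType}.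

Lemma ReD (z w : R[i]) : complex.Re (z + w) = complex.Re z + complex.Re w.
Proof. by case: z; case: w. Qed.

Lemma ImD (z w : R[i]) : complex.Im (z + w) = complex.Im z + complex.Im w.
Proof. by case: z; case: w. Qed.

Lemma ReM (z w : R[i]) :
  complex.Re (z * w) = complex.Re z * complex.Re w - complex.Im z * complex.Im w.
Proof. by case: z; case: w. Qed.

Lemma ImM (z w : R[i]) :
  complex.Im (z * w) = complex.Re z * complex.Im w + complex.Im z * complex.Re w.
Proof. by case: z; case: w. Qed.

Lemma measurable_Re : measurable_fun setT (@complex.Re R).
Proof.
move=> _ A mA; rewrite setTI.
have := measurable_fst (T1 := measurableTypeR R) (T2 := measurableTypeR R) measurableT _ mA.
by rewrite setTI.
Qed.

Lemma measurable_Im : measurable_fun setT (@complex.Im R).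
Proof.
move=> _ A mA; rewrite setTI.
have := measurable_snd (T1 := measurableTypeR R) (T2 := measurableTypeR R) measurableT _ mA.
by rewrite setTI.
Qed.

Lemma measurable_complexP d (T : measurableType d) (F : T -> R[i]) :
  measurable_fun setT F <->
  measurable_fun setT (fun t => complex.Re (F t)) /\
  measurable_fun setT (fun t => complex.Im (F t)).
Proof.
split=> [mF|[mRe mIm] _ A mA]; first by split;
  [exact: (measurableT_comp measurable_Re)|exact: (measurableT_comp measurable_Im)].
have := measurable_fun_pair
  (mRe : measurable_fun setT (_ : T -> measurableTypeR R))
  (mIm : measurable_fun setT (_ : T -> measurableTypeR R)).
move=> /(_ measurableT _ mA).
rewrite !setTI (_ : _ @^-1` _ = F @^-1` A)//.
apply/seteqP; split=> t /=; rewrite /complex_of_pair/=; by case: (F t).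
Qed.

Lemma measurable_complexM d (T : measurableType d) (F G : T -> R[i]) :
  measurable_fun setT F -> measurable_fun setT G ->
  measurable_fun setT (fun t => F t * G t).
Proof.
move=> /measurable_complexP[ReF ImF] /measurable_complexP[ReG ImG].
apply/measurable_complexP; split.
  under eq_fun do rewrite ReM.
  by apply: measurable_funB; exact: measurable_funM.
under eq_fun do rewrite ImM.
by apply: measurable_funD; exact: measurable_funM.
Qed.

Lemma measurable_conjc d (T : measurableType d) (F : T -> R[i]) :
  measurable_fun setT F -> measurable_fun setT (fun t => conjc (F t)).
Proof.
move=> /measurable_complexP[ReF ImF]; apply/measurable_complexP; split.
  by rewrite (_ : (fun t => _) = (fun t => complex.Re (F t)))//;
    apply/funext => t; case: (F t).
rewrite (_ : (fun t => _) = \- (fun t => complex.Im (F t))); first exact: measurable_funN.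
by apply/funext => t /=; case: (F t).
Qed.

Context d (T : measurableType d) (P : probability T R).
Implicit Types F G : T -> R[i].

Definition integrableC F : Prop :=
  P.-integrable setT (EFin \o (fun t => complex.Re (F t))) /\
  P.-integrable setT (EFin \o (fun t => complex.Im (F t))).

Lemma expectationCE F : expectationC P F =
  (\int[P]_t complex.Re (F t)) +i* (\int[P]_t complex.Im (F t)).
Proof. by rewrite /expectationC unlock. Qed.

Lemma le_integrableC F (g : T -> R) : measurable_fun setT F ->
  P.-integrable setT (EFin \o g) -> (forall t, Normc.normc (F t) <= g t) ->
  integrableC F.
Proof.
move=> /measurable_complexP[ReF ImF] ig Fg.
have leF t : `|complex.Re (F t)| <= `|g t| /\ `|complex.Im (F t)| <= `|g t|.
  have Fgt := le_trans (Fg t) (ler_norm _).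
  by split; apply: le_trans Fgt; case: (F t) => a b /=;
    rewrite -sqrtr_sqr ler_wsqrtr// (lerDl, lerDr) sqr_ge0.
split; apply: (le_integrable measurableT _ _ ig); try exact/measurable_EFinP.
  by move=> t _; rewrite lee_fin; case: (leF t).
by move=> t _; rewrite lee_fin; case: (leF t).
Qed.

Lemma integrableCD F G : integrableC F -> integrableC G ->
  integrableC (fun t => F t + G t).
Proof.
move=> [ReF ImF] [ReG ImG]; split.
  under eq_fun do rewrite ReD.
  exact: (integrableD measurableT ReF ReG).
under eq_fun do rewrite ImD.
exact: (integrableD measurableT ImF ImG).
Qed.

Lemma integrableCZ (c : R[i]) F : integrableC F -> integrableC (fun t => c * F t).
Proof.
move=> [ReF ImF]; split.
  under eq_fun do rewrite ReM.
  exact: (integrableB measurableT (integrableZl measurableT _ ReF)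
    (integrableZl measurableT _ ImF)).
under eq_fun do rewrite ImM.
exact: (integrableD measurableT (integrableZl measurableT _ ImF)
  (integrableZl measurableT _ ReF)).
Qed.

Lemma expectationCD F G : integrableC F -> integrableC G ->
  expectationC P (fun t => F t + G t) = expectationC P F + expectationC P G.
Proof.
move=> [ReF ImF] [ReG ImG]; rewrite !expectationCE.
under eq_Rintegral do rewrite ReD.
under [X in _ +i* X]eq_Rintegral do rewrite ImD.
by rewrite !RintegralD.
Qed.

Lemma expectationCZ (c : R[i]) F : integrableC F ->
  expectationC P (fun t => c * F t) = c * expectationC P F.
Proof.
move=> [ReF ImF]; rewrite !expectationCE.
under eq_Rintegral do rewrite ReM.
under [X in _ +i* X]eq_Rintegral do rewrite ImM.
have ZRe a : P.-integrable setT (EFin \o (fun t => a * complex.Re (F t))).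
  exact: (integrableZl measurableT _ ReF).
have ZIm a : P.-integrable setT (EFin \o (fun t => a * complex.Im (F t))).
  exact: (integrableZl measurableT _ ImF).
by rewrite RintegralB// RintegralD// !RintegralZl//; case: c.
Qed.

Lemma expectationC_real (f : T -> R) :
  expectationC P (fun t => (f t)%:C) = (\int[P]_t f t)%:C.
Proof. by rewrite expectationCE/= Rintegral_cst// mul0r. Qed.

Lemma integrableC_real (f : T -> R) :
  P.-integrable setT (EFin \o f) -> integrableC (fun t => (f t)%:C).
Proof. by move=> fi; split => //=; exact: finite_measure_integrable_cst. Qed.

Lemma expectationC_cst (c : R[i]) : expectationC P (fun=> c) = c.
Proof.
by rewrite /expectationC !expectation_cst; case: c.
Qed.

Lemma integrableC_cst (c : R[i]) : integrableC (fun=> c).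
Proof. by split; exact: finite_measure_integrable_cst. Qed.

Lemma integrableC_sum (J : Type) (r : seq J) (F : J -> T -> R[i]) :
  (forall j, integrableC (F j)) -> integrableC (fun t => \sum_(j <- r) F j t).
Proof.
move=> iF; elim: r => [|j r IHr].
  by under eq_fun do rewrite big_nil; exact: integrableC_cst.
by under eq_fun do rewrite big_cons; exact: integrableCD.
Qed.

Lemma expectationC_sum (J : Type) (r : seq J) (F : J -> T -> R[i]) :
  (forall j, integrableC (F j)) ->
  expectationC P (fun t => \sum_(j <- r) F j t) = \sum_(j <- r) expectationC P (F j).
Proof.
move=> iF; elim: r => [|j r IHr].
  by rewrite big_nil; under eq_fun do rewrite big_nil; exact: expectationC_cst.
rewrite big_cons -IHr -expectationCD//; last exact: integrableC_sum.
by under eq_fun do rewrite big_cons.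
Qed.

End ComplexExpectation.

(** * Complex functions of independent variables *)

Section ComplexIndependence.
Local Set Implicit Arguments.
Local Unset Strict Implicit.
Context d (T : measurableType d) d' (T' : measurableType d') (R : realType).
Variables (P : probability T R) (I : finType) (X : I -> {RV P >-> T'}).
Hypothesis indX : mutually_independent [set: I]%SET X.

Lemma measurable_real_complex (f : T' -> R) :
  measurable_fun setT f -> measurable_fun setT (fun x => (f x)%:C).
Proof. by move=> mf; apply/measurable_complexP; split => //=; exact: measurable_cst. Qed.

Let expectationC_prod_ge0 (f : I -> T' -> R) :
  (forall i, measurable_fun setT (f i)) -> (forall i x, 0 <= f i x) ->
  (forall i, P.-integrable setT (EFin \o (fun t => f i (X i t)))) ->
  integrableC P (fun t => \prod_i (f i (X i t))%:C) /\
  expectationC P (fun t => \prod_i (f i (X i t))%:C) =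
  \prod_i expectationC P (fun t => (f i (X i t))%:C).
Proof.
move=> mf f0 fi.
have prodC (F : I -> R) : \prod_i (F i)%:C = (\prod_i F i)%:C.
  by rewrite (rmorph_prod (real_complex R)).
have foo i : (\int[P]_t (f i (X i t))%:E < +oo)%E.
  have /integrableP[_] := fi i; apply: le_lt_trans; rewrite le_eqVlt.
  by apply/orP; left; apply/eqP/eq_integral => t _ /=; rewrite ger0_norm.
have iprod := ge0_integral_prod_indep indX mf f0 foo.
have ip : P.-integrable setT (EFin \o (fun t => \prod_i f i (X i t))).
  apply/integrableP; split.
    apply/measurable_EFinP; apply: measurable_prod => i _.
    exact: measurableT_comp.
  rewrite (eq_integral (fun t => (\prod_i f i (X i t))%:E)) ?iprod ?ltry//.
  by move=> t _ /=; rewrite ger0_norm// prodr_ge0.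
under eq_fun do rewrite prodC.
split; first exact: integrableC_real.
under [RHS]eq_bigr do rewrite expectationC_real.
by rewrite expectationC_real prodC /Rintegral iprod.
Qed.

(** Integrability of the product is carried along in the induction, since additivity of
    [expectationC] is available only for integrable functions. *)
Lemma expectationC_prod_indep (g : I -> T' -> R[i]) :
  (forall i, measurable_fun setT (g i)) ->
  (forall i, integrableC P (fun t => g i (X i t))) ->
  integrableC P (fun t => \prod_i g i (X i t)) /\
  expectationC P (fun t => \prod_i g i (X i t)) =
  \prod_i expectationC P (fun t => g i (X i t)).
Proof.
move=> mg gi.
(* The coordinates outside s carry nonnegative functions: they are freed one at
   a time, by splitting the real and imaginary parts into nonnegative parts. *)
have : forall i, i \notin enum I -> exists f : T' -> R,
    [/\ measurable_fun setT f, forall x, 0 <= f x & g i = fun x => (f x)%:C].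
  by move=> i; rewrite mem_enum.
elim: (enum I) g mg gi => [|i0 s IHs] g mg gi gs.
  have /choice[f fP] : forall i, exists f : T' -> R,
    [/\ measurable_fun setT f, forall x, 0 <= f x & g i = fun x => (f x)%:C].
    by move=> i; exact: gs.
  have gE : g = fun i x => (f i x)%:C by apply/funext => i; case: (fP i).
  rewrite gE; apply: expectationC_prod_ge0.
  - by move=> i; case: (fP i).
  - by move=> i; case: (fP i).
  - by move=> i; have [] := gi i; rewrite gE.
pose W t := \prod_(i | i != i0) g i (X i t).
pose C := \prod_(i | i != i0) expectationC P (fun t => g i (X i t)).
(* With the other coordinates fixed, [good] is closed under sums and complex multiples, so
   nonnegative real functions at [i0] are enough. *)
pose good h := [/\ integrableC P (fun t => h (X i0 t)),
  integrableC P (fun t => h (X i0 t) * W t) &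
  expectationC P (fun t => h (X i0 t) * W t) = expectationC P (fun t => h (X i0 t)) * C].
have goodD h1 h2 : good h1 -> good h2 -> good (fun x => h1 x + h2 x).
  move=> [ih1 iw1 e1] [ih2 iw2 e2]; split; first exact: integrableCD.
    by under eq_fun do rewrite mulrDl; exact: integrableCD.
  under eq_fun do rewrite mulrDl.
  by rewrite !expectationCD// e1 e2 mulrDl.
have goodZ c h : good h -> good (fun x => c * h x).
  move=> [ih iw e]; split; first exact: integrableCZ.
    by under eq_fun do rewrite -mulrA; exact: integrableCZ.
  under eq_fun do rewrite -mulrA.
  by rewrite !expectationCZ// e mulrA.
have goodR (f : T' -> R) : measurable_fun setT f -> (forall x, 0 <= f x) ->
    P.-integrable setT (EFin \o (fun t => f (X i0 t))) -> good (fun x => (f x)%:C).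
  move=> mf f0 fi.
  pose g' i := if i == i0 then (fun x => (f x)%:C) else g i.
  have g'E i : i != i0 -> g' i = g i by rewrite /g' => /negPf->.
  have g'0 : g' i0 = (fun x => (f x)%:C) by rewrite /g' eqxx.
  have [|||ig' eg'] := IHs g'.
  - move=> i; rewrite /g'; case: ifP => // _.
    exact: measurable_real_complex.
  - move=> i; rewrite /g'; case: ifP => // /eqP ->.
    exact: integrableC_real.
  - move=> i is_; have [->|i0i] := eqVneq i i0; first by rewrite g'0; exists f.
    by rewrite g'E//; apply: gs; rewrite inE negb_or i0i.
  have prodE t : \prod_i g' i (X i t) = (f (X i0 t))%:C * W t.
    rewrite (bigD1 i0)//= g'0; congr (_ * _).
    by apply: eq_bigr => i ii0; rewrite g'E.
  split; first exact: integrableC_real.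
    by under eq_fun do rewrite -prodE.
  rewrite (_ : (fun t => (f (X i0 t))%:C * W t) = (fun t => \prod_i g' i (X i t)));
    last by apply/funext => t; rewrite prodE.
  rewrite eg' (bigD1 i0)//= g'0; congr (_ * _).
  by apply: eq_bigr => i ii0; rewrite g'E.
have [iRe iIm] := gi i0.
have /measurable_complexP[mRe mIm] := mg i0.
have part (u : T' -> R) : measurable_fun setT u ->
    P.-integrable setT (EFin \o (fun t => u (X i0 t))) -> good (fun x => (u x)%:C).
  move=> mu iu.
  have iau : P.-integrable setT (EFin \o (fun t => `|u (X i0 t)|)).
    by have := integrable_abse iu; apply: eq_integrable.
  have mau : measurable_fun setT (fun x => `|u x|) by exact: measurableT_comp.
  (* Both [|u|] and [|u| - u] are nonnegative and integrable, and [u] is their difference. *)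
  have -> : (fun x => (u x)%:C) =
      (fun x => (`|u x|)%:C + (-1) * (`|u x| - u x)%:C).
    by apply/funext => x; rewrite mulN1r -rmorphB/= opprB addrC subrK.
  apply: goodD; last apply: goodZ; apply: goodR => //.
  - exact: measurable_funB.
  - by move=> x; rewrite subr_ge0 ler_norm.
  - exact: (integrableB measurableT iau iu).
have gE : g i0 = fun x => (complex.Re (g i0 x))%:C + 'i * (complex.Im (g i0 x))%:C.
  by apply/funext => x; rewrite -complexE.
have [_ iW eW] : good (g i0) by rewrite gE; apply: goodD; [|apply: goodZ]; exact: part.
split.
  by under eq_fun do rewrite (bigD1 i0)//=.
rewrite (bigD1 i0)//= -/C -eW.
congr expectationC; apply/funext => t; exact: bigD1.
Qed.

End ComplexIndependence.

(** * Equality in law and deterministic coordinates *)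

Section Laws.
Local Set Implicit Arguments.
Local Unset Strict Implicit.
Context {R : realType}.
Context d1 (T1 : measurableType d1) d2 (T2 : measurableType d2) d' (T' : measurableType d').
Variables (P : probability T1 R) (Q : probability T2 R).

Section Transfer.
Variables (X : {RV P >-> T'}) (Y : {RV Q >-> T'}).
Hypothesis XY : same_law X Y.

Lemma same_law_ge0_integral (f : T' -> \bar R) :
  measurable_fun setT f -> (forall x, (0 <= f x)%E) ->
  (\int[P]_t f (X t) = \int[Q]_t f (Y t))%E.
Proof.
move=> mf f0; rewrite -(ge0_integral_distribution X)// -(ge0_integral_distribution Y)//.
by apply: eq_measure_integral => A mA _; exact: XY.
Qed.

Lemma same_law_integrable (f : T' -> R) : measurable_fun setT f ->
  Q.-integrable setT (EFin \o (fun t => f (Y t))) ->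
  P.-integrable setT (EFin \o (fun t => f (X t))).
Proof.
move=> mf /integrableP[_ fY]; apply/integrableP; split.
  by apply/measurable_EFinP; exact: measurableT_comp.
rewrite (same_law_ge0_integral (f := fun x => `|(f x)%:E|%E))//.
by apply/measurable_EFinP; exact: measurableT_comp.
Qed.

Lemma same_law_Rintegral (f : T' -> R) : measurable_fun setT f ->
  Q.-integrable setT (EFin \o (fun t => f (Y t))) ->
  \int[P]_t f (X t) = \int[Q]_t f (Y t).
Proof.
move=> mf fY; have fX := same_law_integrable mf fY.
have mEf : measurable_fun setT (EFin \o f) by exact/measurable_EFinP.
congr fine; rewrite -(integral_distribution mEf fX) -(integral_distribution mEf fY).
by apply: eq_measure_integral => A mA _; exact: XY.
Qed.

Lemma same_law_expectationC (g : T' -> R[i]) : measurable_fun setT g ->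
  integrableC Q (fun t => g (Y t)) ->
  integrableC P (fun t => g (X t)) /\
  expectationC P (fun t => g (X t)) = expectationC Q (fun t => g (Y t)).
Proof.
move=> /measurable_complexP[mRe mIm] [iRe iIm]; split.
  by split; [exact: (same_law_integrable mRe iRe)|exact: (same_law_integrable mIm iIm)].
by rewrite !expectationCE (same_law_Rintegral mRe iRe) (same_law_Rintegral mIm iIm).
Qed.

End Transfer.

(** The preimage of a set under a constant is empty or everything: an empty one makes both sides 0,
    and full ones drop out of both sides. *)
Lemma mutually_independent_cst (J : finType) (A : {set J}) (X : J -> {RV P >-> T'})
    (p : J -> T') :
  (forall i, i \in A -> forall t, X i t = p i) ->
  mutually_independent (~: A)%SET X -> mutually_independent [set: J]%SET X.
Proof.
move=> Xp indX K B _ mB.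
have mK i : i \in K -> measurable (X i @^-1` B i).
  by move=> iK; apply: measurable_funPTI => //; exact: mB.
have [[i [iK iA npB]]|allB] := pselect (exists i, [/\ i \in K, i \in A & ~ B i (p i)]).
  have X0 : X i @^-1` B i = set0.
    by apply/seteqP; split => // t /=; rewrite Xp.
  rewrite (bigD1 i)//= X0 measure0 mul0e.
  rewrite (_ : \bigcap_(_ in _) _ = set0) ?measure0//.
  by apply/seteqP; split => // t /(_ i iK); rewrite X0.
have XT i : i \in K -> i \in A -> X i @^-1` B i = setT.
  move=> iK iA; apply/seteqP; split => // t _ /=; rewrite Xp//.
  by apply: contrapT => npB; apply: allB; exists i.
rewrite (bigID (mem A))/= [X in (X * _)%E]big1 ?mul1e; last first.
  by move=> i /andP[iK iA]; rewrite XT//; exact: probability_setT.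
transitivity (\prod_(i in K :\: A) P (X i @^-1` B i))%E; last first.
  by apply: eq_bigl => i; rewrite !finset.inE andbC.
transitivity (P (\bigcap_(i in [set` (K :\: A)%SET]) (X i @^-1` B i))).
  congr (P _); apply/seteqP; split => t /= h i.
    by rewrite /= !finset.inE => /andP[_ iK]; exact: h.
  move=> iK; have [iA|iA] := boolP (i \in A); first by rewrite XT.
  by apply: h; rewrite /= !finset.inE iA.
apply: indX; first by apply/fintype.subsetP => i; rewrite !finset.inE => /andP[].
by move=> i; rewrite !finset.inE => /andP[_ iK]; exact: mB.
Qed.

End Laws.

(** * The ambiguity function *)

Section Dft.
Local Set Implicit Arguments.
Local Unset Strict Implicit.
Context {R : realType}.

Lemma conjE (z : R[i]) : Num.conj z = conjc z.
Proof. by []. Qed.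

Lemma conjcM (z w : R[i]) : conjc (z * w) = conjc z * conjc w.
Proof. exact: rmorphM. Qed.

Lemma expjD (x y : R) : expj (x + y) = expj x * expj y.
Proof. by rewrite /expj cosD sinD; congr Complex; rewrite addrC mulrC. Qed.

Lemma expjN (x : R) : expj (- x) = conjc (expj x).
Proof. by rewrite /expj cosN sinN. Qed.

Lemma expj_norm (x : R) : expj x * conjc (expj x) = 1.
Proof. by rewrite -expjN -expjD subrr /expj cos0 sin0. Qed.

Lemma expjMn (x : R) n : expj (x * n%:R) = expj x ^+ n.
Proof.
elim: n => [|n IHn]; first by rewrite mulr0 /expj cos0 sin0.
by rewrite -natr1 mulrDr mulr1 expjD IHn exprSr.
Qed.

(** By the half-angle formula [cos x = 1 - 2 sin(x/2)^2], and [sin(x/2) > 0] on this range, so the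
    real part is below 1. *)
Lemma expj_eq1 (x : R) : 0 < x < 2 * pi -> expj x != 1.
Proof.
move=> /andP[x0 x2]; apply/eqP => -[+ _].
have : 0 < sin (x / 2).
  by apply: sin_gt0_pi; rewrite divr_gt0//= ltr_pdivrMr// mulrC.
have -> : cos x = 1 - sin (x / 2) ^+ 2 *+ 2.
  rewrite {1}(splitr x) cosD -!expr2 cos2sin2; lra.
nra.
Qed.

Lemma prim_expj N : (0 < N)%N -> N.-primitive_root (expj (2 * pi / N%:R : R)).
Proof.
move=> N0; have NR : 0 < N%:R :> R by rewrite ltr0n.
apply/andP; split => //; apply/forallP => i; apply/eqP.
rewrite unity_rootE -expjMn.
have [->|iN] := eqVneq i.+1 N.
  rewrite divfK ?(lt0r_neq0 NR)// (_ : 2 * pi = pi + pi :> R); last by lra.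
  by rewrite /expj cosDpi sinDpi cospi sinpi opprK oppr0 eqxx.
apply/negbTE/expj_eq1.
have iltN : (i.+1 < N)%N by rewrite ltn_neqAle iN ltn_ord.
rewrite !mulr_gt0 ?invr_gt0 ?pi_gt0//= -[ltRHS]mulr1 -mulrA ltr_pM2l; last first.
  by rewrite mulr_gt0 ?pi_gt0.
by rewrite mulrC ltr_pdivrMr// mul1r ltr_nat.
Qed.

Lemma sum_unity_expr (F : fieldType) N (w : F) : w ^+ N = 1 ->
  \sum_(n < N) w ^+ n = (if w == 1 then N%:R else 0).
Proof.
move=> wN; case: eqP => [->|/eqP w1].
  by under eq_bigr do rewrite expr1n; rewrite sumr_const card_ord.
have /eqP := subrX1 w N; rewrite wN subrr eq_sym mulf_eq0 subr_eq0 (negbTE w1)/=.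
by move=> /eqP.
Qed.

Variable N : nat.
Hypothesis N0 : (0 < N)%N.
Let z : R[i] := expj (2 * pi / N%:R).
Let zN : N.-primitive_root z := prim_expj N0.

Lemma expj_root (m : nat) : expj (2 * pi * m%:R / N%:R : R) = z ^+ m.
Proof. by rewrite -expjMn; congr expj; ring. Qed.

Lemma ofdmE (s : 'cV[R[i]]_N) n :
  ofdm s n ord0 = \sum_(m < N) (Num.sqrt N%:R)^-1%:C * z ^+ (m * n) * s m ord0.
Proof.
rewrite /ofdm mxE; apply: eq_bigr => m _; rewrite !mxE conjE conjcM.
by rewrite expjN expj_root conjcK conjc_real.
Qed.

Lemma dpafE (x : 'cV[R[i]]_N) k q : dpaf x k q =
  \sum_(n < N) conjc (x (subI n k) ord0) * conjc (z ^+ (q * n)) * x n ord0.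
Proof.
rewrite /dpaf mxE; apply: eq_bigr => n _; congr (_ * _).
rewrite mxE (bigD1 n)//= big1 ?addr0; last first.
  move=> i ni; rewrite !mxE (negbTE ni) mulr0n conjE conjc0 mulr0 //.
rewrite !mxE eqxx mulr1n conjE expj_root; congr (_ * _).
rewrite (bigD1 (subI n k))//= big1 ?addr0.
  by rewrite !mxE eqxx mulr1.
by move=> i ni; rewrite !mxE (negbTE ni) mulr0.
Qed.

Lemma root_subI m (n k : 'I_N) : z ^+ (m * subI n k) = z ^+ (m * (n + (N - k))).
Proof. by apply/eqP; rewrite (eq_prim_root_expr zN) /= modnMmr. Qed.

(** Trades the truncated subtraction in [subI] for a congruence, the form in which exponents of a
    primitive root are compared. *)
Lemma subI_eq (n m q : 'I_N) : (m == subI n q) = (n == m + q %[mod N]).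
Proof.
have qN := ltnW (ltn_ord q).
apply/eqP/eqP => [->/=|nmq].
  by rewrite modnDml -addnA subnK// modnDr.
apply: val_inj => /=.
by rewrite -modnDml nmq modnDml -addnA subnKC// modnDr modn_small.
Qed.

Lemma conj_root m : conjc (z ^+ m) * z ^+ m = 1.
Proof. by rewrite mulrC /z -expjMn expj_norm. Qed.

(** The summand is the [n]-th power of a single [N]-th root of unity [w], and [w = 1] exactly when
    [m'] is congruent to [m + q]. *)
Lemma sum_root (m m' q : 'I_N) :
  \sum_(n < N) conjc (z ^+ (m * n)) * conjc (z ^+ (q * n)) * z ^+ (m' * n) =
  (if m == subI m' q then N%:R else 0).
Proof.
rewrite subI_eq -(eq_prim_root_expr zN).
pose w := conjc (z ^+ (m + q)) * z ^+ m'.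
have wE n : conjc (z ^+ (m * n)) * conjc (z ^+ (q * n)) * z ^+ (m' * n) = w ^+ n.
  by rewrite /w exprMn -rmorphXn -rmorphM -!exprM -exprD mulnDl.
under eq_bigr do rewrite wE.
rewrite sum_unity_expr; last first.
  rewrite /w exprMn -rmorphXn -!exprM ![(_ * N)%N]mulnC !exprM.
  by rewrite (prim_expr_order zN) !expr1n rmorph1 mulr1.
suff -> : (w == 1) = (z ^+ m' == z ^+ (m + q)) by [].
apply/eqP/eqP => [w1|mq]; last by rewrite /w mq; exact: conj_root.
by rewrite -[LHS]mul1r -(conj_root (m + q)) mulrAC -/w w1 mul1r.
Qed.

(** The DFT exchanges modulation and delay: the modulation by [q] becomes a cyclic shift of the
    symbols, and the delay [k] survives only as a phase. The conjugated exponent [N - k] encodes the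
    phase with exponent [+k]. *)
Lemma dpaf_ofdm (s : 'cV[R[i]]_N) k q : dpaf (ofdm s) k q =
  \sum_(n < N) conjc (z ^+ (subI n q * (N - k))) * s n ord0 * conjc (s (subI n q) ord0).
Proof.
pose r : R[i] := (Num.sqrt N%:R)^-1%:C.
(* The two DFT normalizations cancel the [N] produced by orthogonality. *)
have rr : r * r * N%:R = 1.
  rewrite -[N%:R](rmorph_nat (real_complex R)) -!rmorphM/= -invfM -expr2 sqr_sqrtr//.
  by rewrite mulVf ?pnatr_eq0 -?lt0n.
rewrite dpafE.
transitivity (\sum_(n < N) \sum_(m' < N) \sum_(m < N)
  (r * r * (conjc (z ^+ (m * (N - k))) * s m' ord0 * conjc (s m ord0)) *
   (conjc (z ^+ (m * n)) * conjc (z ^+ (q * n)) * z ^+ (m' * n)))).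
  apply: eq_bigr => n _; rewrite !ofdmE rmorph_sum mulr_sumr; apply: eq_bigr => m' _.
  rewrite !mulr_suml; apply: eq_bigr => m _ /=.
  rewrite root_subI mulnDr exprD !conjcM conjc_real -/r; ring.
rewrite exchange_big; apply: eq_bigr => m' _; rewrite exchange_big /=.
under eq_bigr do rewrite -mulr_sumr sum_root.
rewrite (bigD1 (subI m' q))//= eqxx big1 ?addr0 => [|m /negPf->]; last by rewrite mulr0.
by rewrite mulrAC rr mul1r.
Qed.

End Dft.

(** * Second moments *)

Section Pilots.
Local Set Implicit Arguments.
Local Unset Strict Implicit.
Context {R : realType}.

Lemma mulcJ (z : R[i]) : z * conjc z = (Normc.normc z ^+ 2)%:C.
Proof.
case: z => a b; rewrite /= sqr_sqrtr ?addr_ge0 ?sqr_ge0//.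
by congr Complex; ring.
Qed.

Context d1 (T : measurableType d1) d2 (T' : measurableType d2).
Variables (P : probability T R) (Q : probability T' R) (N : nat) (I : {set 'I_N}).
Variable d : {RV Q >-> R[i]}.
Hypothesis Ed : expectationC Q d = 0.
Hypothesis Ed_normsq : ('E_Q[fun t => (Normc.normc (d t) ^+ 2)%R] = 1)%E.
Hypothesis Ed_sq : expectationC Q (fun t => d t ^+ 2) = 0.
Variables (s : 'I_N -> {RV P >-> R[i]}) (p : 'I_N -> R[i]).
Hypothesis norm_p : forall i, i \in I -> Normc.normc (p i) = 1.
Hypothesis s_pilot : forall i, i \in I -> forall t, s i t = p i.
Hypothesis s_law : forall i, i \notin I -> same_law (s i) d.
Hypothesis s_ind : mutually_independent (~: I)%SET s.

Let md : measurable_fun setT d. Proof. by []. Qed.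

Let normsq_integrable : Q.-integrable setT (EFin \o (fun t => Normc.normc (d t) ^+ 2)).
Proof.
apply/integrableP; split.
  apply/measurable_EFinP.
  (* The squared modulus is measurable as the real part of [d * conjc d]. *)
  have /measurable_complexP[mR _] := measurable_complexM md (measurable_conjc md).
  by under eq_fun do rewrite -[_ ^+ 2]/(complex.Re (_ ^+ 2)%:C) -mulcJ.
rewrite (eq_integral (fun t => (Normc.normc (d t) ^+ 2)%:E)).
  by move: Ed_normsq; rewrite unlock => ->; rewrite ltry.
by move=> t _ /=; rewrite ger0_norm ?sqr_ge0.
Qed.

Let quad_integrable (g : R[i] -> R[i]) : measurable_fun setT g ->
  (forall z, Normc.normc (g z) <= 1 + Normc.normc z ^+ 2) ->
  integrableC Q (fun t => g (d t)).
Proof.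
move=> mg gle; apply: (le_integrableC (g := fun t => 1 + Normc.normc (d t) ^+ 2)) => //.
- exact: measurableT_comp.
- have i1 : Q.-integrable setT (EFin \o (fun=> 1)) by exact: finite_measure_integrable_cst.
  exact: (integrableD measurableT i1 normsq_integrable).
Qed.

Let expectationC_conj F : integrableC Q F ->
  expectationC Q (fun t => conjc (F t)) = conjc (expectationC Q F).
Proof.
move=> [_ iIm]; rewrite !expectationCE/= -mulN1r -RintegralZl//; congr Complex.
  by apply: eq_Rintegral => t _; case: (F t).
by apply: eq_Rintegral => t _; rewrite mulN1r; case: (F t).
Qed.

Let mid : measurable_fun setT (fun z : R[i] => z). Proof. exact: measurable_id. Qed.
Let normc_ge0 (z : R[i]) : 0 <= Normc.normc z.
Proof. by case: z => a b; exact: sqrtr_ge0. Qed.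

Let normcJ (z : R[i]) : Normc.normc (conjc z) = Normc.normc z.
Proof. by case: z => a b /=; rewrite sqrrN. Qed.

(* The contribution of the symbol with index i to s_n (s_a)^* (s_m (s_b)^* )^*, the
   booleans telling whether i is n, a, m and b. *)
Let factor (b1 b2 b3 b4 : bool) (z : R[i]) : R[i] :=
  (if b1 then z else 1) * conjc (if b2 then z else 1) *
  conjc ((if b3 then z else 1) * conjc (if b4 then z else 1)).

Let measurable_factor b1 b2 b3 b4 : measurable_fun setT (factor b1 b2 b3 b4).
Proof.
have mif b : measurable_fun setT (fun z : R[i] => if b then z else 1).
  by case: b => //; exact: measurable_cst.
rewrite /factor; apply: measurable_complexM.
  by apply: measurable_complexM => //; exact: measurable_conjc.
by apply/measurable_conjc/measurable_complexM => //; exact: measurable_conjc.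
Qed.

(** The premises say that the index is at most one of [n], [a] and at most one of [m], [b]. The
    modulus is thus [|z|^k] with [k <= 2], which the second moment controls. *)
Let normc_factor (b1 b2 b3 b4 : bool) z : ~~ (b1 && b2) -> ~~ (b3 && b4) ->
  Normc.normc (factor b1 b2 b3 b4 z) <= 1 + Normc.normc z ^+ 2.
Proof.
have nif (b : bool) : Normc.normc (if b then z else 1) = Normc.normc z ^+ b.
  by case: b; rewrite ?Normc.normc1.
rewrite /factor !(Normc.normcM, normcJ) !nif -!exprD => b12 b34.
have : (b1 + b2 + (b3 + b4) <= 2)%N by case: b1 b12; case: b2; case: b3 b34; case: b4.
have := normc_ge0 z; move: (b1 + b2 + (b3 + b4))%N => k z0.
by case: k => [|[|[|//]]] _; rewrite ?expr0 ?expr1; nra.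
Qed.

Let factor_integrable (b1 b2 b3 b4 : bool) : ~~ (b1 && b2) -> ~~ (b3 && b4) ->
  integrableC Q (fun t => factor b1 b2 b3 b4 (d t)).
Proof. by move=> b12 b34; apply: quad_integrable => // z; exact: normc_factor. Qed.

Let expectationC_normsq : expectationC Q (fun t => d t * conjc (d t)) = 1.
Proof.
under eq_fun do rewrite mulcJ.
rewrite expectationC_real; congr (_%:C).
by move: Ed_normsq; rewrite /Rintegral unlock => ->.
Qed.

(** On the diagonal [n = m], [a = b], a symbol enters as [|d|^2] or not at all. *)
Let factor_diag (b1 b2 : bool) : ~~ (b1 && b2) ->
  expectationC Q (fun t => factor b1 b2 b1 b2 (d t)) = 1.
Proof.
rewrite -[RHS]expectationC_normsq /factor; case: b1; case: b2 => // _; last first.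
  rewrite expectationC_normsq; under eq_fun do rewrite !(conjc1, mulr1).
  exact: expectationC_cst.
- by under eq_fun do rewrite !(conjc1, mul1r, conjcK) mulrC.
- by under eq_fun do rewrite !(conjc1, mulr1).
Qed.

(** Positions [n] and [b] are unconjugated, [a] and [m] conjugated. The four premises exclude every
    coincidence of a conjugated with an unconjugated position, so [|d|^2] never appears: what is
    left is 1, [d], [d^2] or a conjugate. *)
Let factor_offdiag (b1 b2 b3 b4 : bool) :
  ~~ (b1 && b2) -> ~~ (b3 && b4) -> ~~ (b1 && b3) -> ~~ (b2 && b4) ->
  expectationC Q (fun t => factor b1 b2 b3 b4 (d t)) = (~~ [|| b1, b2, b3 | b4])%:R.
Proof.
have i1 : integrableC Q d.
  apply: (quad_integrable mid) => z; have := normc_ge0 z; nra.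
have i2 : integrableC Q (fun t => d t ^+ 2).
  under eq_fun do rewrite expr2.
  apply: (quad_integrable (measurable_complexM mid mid)) => z.
  by rewrite Normc.normcM -expr2 lerDr.
have c1 : expectationC Q (fun t => conjc (d t)) = 0.
  by rewrite expectationC_conj// Ed conjc0.
have c2 : expectationC Q (fun t => conjc (d t) * conjc (d t)) = 0.
  under eq_fun do rewrite -rmorphM -expr2.
  by rewrite expectationC_conj// Ed_sq conjc0.
have s2 : expectationC Q (fun t => d t * d t) = 0.
  by rewrite -Ed_sq; congr expectationC; apply/funext => t; rewrite expr2.
rewrite /factor; case: b1; case: b2; case: b3; case: b4 => // _ _ _ _;
  under eq_fun do rewrite !(conjc1, mulr1, mul1r, conjcK); rewrite ?expectationC_cst.
all: by rewrite /= ?s2 ?c2 ?c1 ?[LHS]Ed.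
Qed.


Let indep : mutually_independent [set: 'I_N]%SET s.
Proof. exact: mutually_independent_cst s_pilot s_ind. Qed.

Let factor_law (b1 b2 b3 b4 : bool) i : ~~ (b1 && b2) -> ~~ (b3 && b4) ->
  integrableC P (fun t => factor b1 b2 b3 b4 (s i t)) /\
  expectationC P (fun t => factor b1 b2 b3 b4 (s i t)) =
  if i \in I then factor b1 b2 b3 b4 (p i)
  else expectationC Q (fun t => factor b1 b2 b3 b4 (d t)).
Proof.
move=> b12 b34; case: ifPn => iI.
  under eq_fun do rewrite s_pilot//.
  by rewrite expectationC_cst; split; [exact: integrableC_cst|].
exact: (same_law_expectationC (s_law iI) (measurable_factor b1 b2 b3 b4)
  (factor_integrable b12 b34)).
Qed.

(** Brings the summand into the shape required by the product formula; [x] is general because it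
    serves for the random symbols and for the pilot values. *)
Let prod_factor (n a m b : 'I_N) (x : 'I_N -> R[i]) :
  \prod_i factor (i == n) (i == a) (i == m) (i == b) (x i) =
  x n * conjc (x a) * conjc (x m * conjc (x b)).
Proof.
have pick j : \prod_i (if i == j then x i else 1) = x j.
  by rewrite -big_mkcond big_pred1_eq.
rewrite /factor !big_split/= -!rmorph_prod/= big_split/= -!rmorph_prod/=.
by rewrite !pick.
Qed.

(** The off-diagonal value is a function of [(n, a)] times the conjugate of the same function of
    [(m, b)]; this separation is what later produces a squared modulus. *)
Lemma expectationC_pairs (n a m b : 'I_N) :
  n != a -> m != b -> (n == m) = (a == b) ->
  integrableC P (fun t => s n t * conjc (s a t) * conjc (s m t * conjc (s b t))) /\
  expectationC P (fun t => s n t * conjc (s a t) * conjc (s m t * conjc (s b t))) =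
  if n == m then 1 else
  (if (n \in I) && (a \in I) then p n * conjc (p a) else 0) *
  conjc (if (m \in I) && (b \in I) then p m * conjc (p b) else 0).
Proof.
move=> na mb nmab.
under eq_fun do rewrite -(prod_factor n a m b (fun i => s i _)).
have neq2 (j k i : 'I_N) : j != k -> ~~ ((i == j) && (i == k)).
  by apply: contra => /andP[/eqP<- /eqP<-].
pose g i := factor (i == n) (i == a) (i == m) (i == b).
have gE i := factor_law i (neq2 _ _ i na) (neq2 _ _ i mb).
have [ig ->] := expectationC_prod_indep indep (g := g)
  (fun i => measurable_factor _ _ _ _) (fun i => (gE i).1).
split=> //; under eq_bigr do rewrite (gE _).2.
case: eqVneq => [nm|nm].
  have ab : a = b by apply/eqP; rewrite -nmab nm eqxx.
  apply: big1 => i _; rewrite -nm -ab; case: ifPn => iI.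
    rewrite /factor; have pp : p i * conjc (p i) = 1 by rewrite mulcJ norm_p// expr1n.
    have := neq2 _ _ i na; case: (i == n); case: (i == a) => // _;
      by rewrite ?(conjc1, mulr1, mul1r, conjcK)// mulrC.
  by apply: factor_diag; exact: neq2.
have ab : a != b by rewrite -nmab.
have off i : expectationC Q (fun t => g i (d t)) =
    (~~ [|| i == n, i == a, i == m | i == b])%:R.
  by apply: factor_offdiag; exact: neq2.
(* If all four are pilots, every data index differs from them and contributes 1; otherwise a data
   index among the four contributes 0 and kills the product. *)
have [allI|] := boolP [&& n \in I, a \in I, m \in I & b \in I].
  have [-> -> -> ->] : [/\ n \in I, a \in I, m \in I & b \in I] by apply/and4P.
  rewrite -(prod_factor n a m b p); apply: eq_bigr => i _; case: ifPn => // iI.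
  rewrite [LHS]off /factor.
  case/and4P: allI => nI aI mI bI.
  have ni j : j \in I -> (i == j) = false.
    by move=> jI; apply/negbTE; apply: contraNneq iI => ->.
  by rewrite !ni// !(conjc1, mulr1).
move=> notI; have [j jI jn] : exists2 j, j \notin I & [|| j == n, j == a, j == m | j == b].
  move: notI; rewrite !negb_and => /or4P[] h;
    [exists n|exists a|exists m|exists b] => //; by rewrite eqxx ?orbT.
rewrite (bigD1 j)//= (negbTE jI) [X in X * _]off jn mul0r.
move: notI; rewrite andbA; case: ((n \in I) && (a \in I)) => /= [/negbTE->|_].
  by rewrite conjc0 mulr0.
by rewrite mul0r.
Qed.

(** Of the shift by [q], only injectivity and the absence of fixed points matter: the first gives
    [n = m] iff [a n = a m], the second keeps a symbol from being paired with itself. *)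
Lemma second_moment_pairs (c : 'I_N -> R[i]) (a : 'I_N -> 'I_N) :
  (forall n, c n * conjc (c n) = 1) -> injective a -> (forall n, n != a n) ->
  ('E_P[fun t => (Normc.normc (\sum_n c n * (s n t * conjc (s (a n) t))) ^+ 2)%R] =
   (N%:R - #|[set n | (n \in I) && (a n \in I)]%SET|%:R +
    Normc.normc (\sum_(n | (n \in I) && (a n \in I))
      c n * (p n * conjc (p (a n)))) ^+ 2)%:E)%E.
Proof.
move=> cc a_inj na.
pose pair n t := s n t * conjc (s (a n) t).
pose u n := if (n \in I) && (a n \in I) then p n * conjc (p (a n)) else 0.
have pairs n m : integrableC P (fun t => pair n t * conjc (pair m t)) /\
    expectationC P (fun t => pair n t * conjc (pair m t)) =
    if n == m then 1 else u n * conjc (u m).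
  by apply: expectationC_pairs => //; rewrite (inj_eq a_inj).
pose F t := \sum_n \sum_m c n * conjc (c m) * (pair n t * conjc (pair m t)).
have FE t : (Normc.normc (\sum_n c n * pair n t) ^+ 2)%:C = F t.
  rewrite -mulcJ rmorph_sum mulr_suml; apply: eq_bigr => n _.
  by rewrite mulr_sumr; apply: eq_bigr => m _ /=; rewrite conjcM mulrACA.
have iF n m : integrableC P (fun t => c n * conjc (c m) * (pair n t * conjc (pair m t))).
  exact: integrableCZ (pairs n m).1.
have intF : integrableC P F by apply: integrableC_sum => n; exact: integrableC_sum.
have eZ n m : expectationC P (fun t => c n * conjc (c m) * (pair n t * conjc (pair m t))) =
    c n * conjc (c m) * (if n == m then 1 else u n * conjc (u m)).
  by rewrite (expectationCZ _ (pairs n m).1) (pairs n m).2.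
(* The off-diagonal sum is completed to a full double sum, a squared modulus. The diagonal terms
   added are subtracted again from the true diagonal values 1; they are 1 on pilot pairs and 0
   elsewhere, whence [N] minus the number of pilot pairs. *)
have EF : expectationC P F = \sum_n \sum_m (c n * u n * conjc (c m * u m)) +
    \sum_n (1 - (c n * u n) * conjc (c n * u n)).
  rewrite expectationC_sum; last by move=> n; exact: integrableC_sum.
  rewrite -big_split; apply: eq_bigr => n _ /=.
  rewrite expectationC_sum// (bigD1 n)//= [in RHS](bigD1 n)//= eZ eqxx cc mulr1.
  rewrite addrAC addrCA subrr addr0; congr (_ + _).
  apply: eq_bigr => m mn; rewrite eZ eq_sym (negbTE mn) conjcM; exact: mulrACA.
pose V := \sum_(n | (n \in I) && (a n \in I)) c n * (p n * conjc (p (a n))).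
have VE : V = \sum_n c n * u n.
  by rewrite /V big_mkcond; apply: eq_bigr => n _; rewrite /u; case: ifP; rewrite ?mulr0.
have uu n : (c n * u n) * conjc (c n * u n) = ((n \in I) && (a n \in I))%:R.
  rewrite conjcM mulrACA cc mul1r /u; case: ifP => [/andP[nI aI]|_]; last by rewrite mul0r.
  by rewrite mulcJ Normc.normcM normcJ !norm_p// mulr1 expr1n.
have EFV : expectationC P F =
    (N%:R - #|[set n | (n \in I) && (a n \in I)]%SET|%:R + Normc.normc V ^+ 2)%:C.
  transitivity (N%:R - #|[set n | (n \in I) && (a n \in I)]%SET|%:R + V * conjc V);
    last by rewrite mulcJ rmorphD rmorphB !rmorph_nat.
  rewrite EF addrC VE rmorph_sum mulr_suml; congr (_ + _).
    rewrite sumrB sumr_const card_ord; congr (_ - _).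
    under eq_bigr do rewrite uu.
    rewrite -natr_sum -sum1_card [in RHS]big_mkcond; congr (_%:R).
    by apply: eq_bigr => n _; rewrite finset.inE; case: ifP.
  by apply: eq_bigr => n _; rewrite mulr_sumr.
(* [expectationC] sees the expectation only through [fine]; integrability of [F] turns the real
   equation back into one of extended reals. *)
move: EFV; rewrite expectationCE => -[+ _].
rewrite -/V => <-; rewrite unlock /Rintegral fineK; last first.
  by apply: integrable_fin_num => //; exact: intF.1.
by apply: eq_integral => t _; rewrite -FE.
Qed.

End Pilots.

(** * Overlaps of the pilot pattern with its cyclic shifts, and the bounds *)

Lemma overlapE (N : nat) (I : {set 'I_N}) (q : 'I_N) :
  overlap I q = #|[set n | (n \in I) && (subI n q \in I)]%SET|.
Proof.
rewrite /overlap -sum1_card [RHS]big_mkcond; apply: eq_bigr => n _.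
by rewrite /Defs.mask finset.inE; case: (n \in I); case: (subI n q \in I).
Qed.

Lemma overlap_le (N : nat) (I : {set 'I_N}) (q : 'I_N) : (overlap I q <= #|I|)%N.
Proof.
rewrite overlapE; apply: subset_leq_card; apply/fintype.subsetP => n.
by rewrite finset.inE => /andP[].
Qed.

Lemma subI_inj (N : nat) (q : 'I_N) : injective (fun n : 'I_N => subI n q).
Proof.
move=> n m /= nm; apply: val_inj.
have : m == subI n q + q %[mod N] by rewrite -subI_eq nm.
have : n == subI n q + q %[mod N] by rewrite -subI_eq.
by move=> /eqP <- /eqP; rewrite !modn_small.
Qed.

Lemma subI_neq (N : nat) (n q : 'I_N) : val q <> 0%N -> n != subI n q.
Proof.
move=> q0; rewrite subI_eq -[X in X == _ %[mod N]]addn0 eqn_modDl mod0n modn_small//.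
by rewrite eq_sym; exact/eqP.
Qed.

Theorem proposition1 (R : realType)
    (* probability spaces carrying the symbols s and the data symbol d *)
    (disp : measure_display) (T : measurableType disp) (P : probability T R)
    (disp' : measure_display) (T' : measurableType disp') (Q : probability T' R)
    (N L : nat) (hN : (1 <= N)%N) (hL : (L <= N)%N)
    (I : {set 'I_N}) (hI : #|I| = L)
    (d : {RV Q >-> R[i]})
    (hd4 : ('E_Q[fun t => (Normc.normc (d t) ^+ 4)%R] < +oo)%E)
    (hd1 : expectationC Q d = 0)
    (hd2 : ('E_Q[fun t => (Normc.normc (d t) ^+ 2)%R] = 1)%E)
    (hd2' : expectationC Q (fun t => d t ^+ 2) = 0)
    (hd3 : expectationC Q (fun t => d t * `|d t| ^+ 2) = 0)
    (hd3' : expectationC Q (fun t => (d t)^* * `|d t| ^+ 2) = 0)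
    (s : 'I_N -> {RV P >-> R[i]})
    (* unit-amplitude deterministic pilots *)
    (p : 'I_N -> R[i])
    (hp : forall i, i \in I -> Normc.normc (p i) = 1)
    (hs : forall i, i \in I -> forall t, s i t = p i)
    (* i.i.d. data symbols *)
    (hlaw : forall i, i \notin I -> same_law (s i) d)
    (hind : mutually_independent (~: I)%SET s)
    (k q : 'I_N) (hq : val q <> 0%N) :
  let h : R := (overlap I q)%:R in
  let EX2 := ('E_P[fun t =>
    (Normc.normc (dpaf (ofdm (\col_(i < N) s i t)) k q) ^+ 2)%R])%E in
  ((N%:R - h)%:E <= EX2)%E /\ N%:R - L%:R <= N%:R - h /\
  (EX2 <= (N%:R + h ^+ 2 - h)%:E)%E /\
  N%:R + h ^+ 2 - h <= N%:R + L%:R ^+ 2 - L%:R.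
Proof.
move=> h EX2.
(* The delay [k] is hidden in the phases [c]; only their modulus is used, so the bounds are uniform
   in [k]. *)
have [c [cc cE]] : exists c : 'I_N -> R[i], (forall n, c n * conjc (c n) = 1) /\
    forall x : 'cV[R[i]]_N, dpaf (ofdm x) k q =
      \sum_n c n * (x n ord0 * conjc (x (subI n q) ord0)).
  exists (fun n => conjc (expj (2 * pi / N%:R) ^+ (subI n q * (N - k)))); split.
    by move=> n; rewrite conjcK conj_root.
  by move=> x; rewrite dpaf_ofdm//; apply: eq_bigr => n _; rewrite mulrA.
pose S : R[i] := \sum_(n | (n \in I) && (subI n q \in I)) c n * (p n * conjc (p (subI n q))).
have EX2E : EX2 = (N%:R - h + Normc.normc S ^+ 2)%:E.
  rewrite /h overlapE -(second_moment_pairs hd1 hd2 hd2' hp hs hlaw hind cc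
    (subI_inj _ q) (fun n => subI_neq _ n q hq)).
  congr expectation; apply/funext => t; rewrite cE.
  by under eq_bigr do rewrite !mxE.
have normS : Normc.normc S <= h.
  have normc1 z : z * conjc z = 1 -> Normc.normc z = 1 :> R.
    rewrite mulcJ => -[/eqP]; rewrite sqrp_eq1; first by move/eqP.
    by case: z => a b; exact: sqrtr_ge0.
  apply: (le_trans (y := \sum_(n | (n \in I) && (subI n q \in I))
      Normc.normc (c n * (p n * conjc (p (subI n q)))))).
    rewrite /S; elim/big_ind2 : _ => [|z x w y zx wy|//]; first by rewrite Normc.normc0.
    by rewrite (le_trans (le_normcD _ _))// lerD.
  rewrite /h overlapE -sum1_card natr_sum [leRHS]big_mkcond [leLHS]big_mkcond.
  apply: ler_sum => n _; rewrite finset.inE; case: ifP => // /andP[nI aI].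
  rewrite !Normc.normcM normc1// hp// mul1r mul1r normc1//.
  by rewrite conjcK mulrC mulcJ hp// expr1n.
have hL' : h <= L%:R by rewrite ler_nat -hI overlap_le.
have S0 : 0 <= Normc.normc S by case: S {EX2E normS} => x y; exact: sqrtr_ge0.
rewrite EX2E !lee_fin; split; [|split; [|split]].
- by rewrite lerDl sqr_ge0.
- by rewrite lerD2l lerN2.
- by rewrite addrAC lerD2r lerD2l ler_sqr// nnegrE (le_trans S0).
(* [x ^ 2 - x] is increasing on the naturals but not on all nonnegative reals, so integrality
   matters here; the inequality is stated in [nat] with the subtractions moved across. *)
- have oL : (overlap I q ^ 2 + L <= L ^ 2 + overlap I q)%N.
    have := overlap_le _ I q; rewrite hI => /subnKC <-.
    by case: (L - _)%N => [|j]; nia.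
  rewrite -!addrA lerD2l lerBlDr addrAC lerBrDr /h -!natrX -!natrD ler_nat.
  exact: oL.
Qed.
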